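(* For every integer $n \geq 4$, \[ \overline{\theta}(K_n) \geq \max_{x \in \mathbb{Z},\ 1\leq x \leq n/2}\frac{\binom{n}{2} - 2\binom{x}{2}-3}{3n-2x-7}. \] Moreover, for every integer $n\geq 12$, \[ \overline{\theta}(K_n) \geq \left\lceil \frac{3-\sqrt{7}}{2}\, n +0.342\right\rceil \geq \left\lceil\frac{n}{5.646} + 0.342\right\rceil. \]
   Context: The geometric thickness $\overline{\theta}(G)$ of a graph $G$ is the smallest integer $k$ such that there is an injective placement of the vertices of $G$ at points of the plane, with each edge drawn as the straight line segment between the points of its endpoints and containing no other vertex point, together with an assignment of each edge to one of $k$ layers, such that no two edges assigned to the same layer cross (i.e., two edges in the same layer meet at most in a common endpoint). $K_n$ denotes the complete graph on $n$ vertices. *)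

(* Defs.v *)
From HB Require Import structures.
From mathcomp Require Import all_boot all_order all_algebra.
From mathcomp Require Import reals.
Unset Printing Implicit Defensive.
Import Order.TTheory GRing.Theory Num.Theory.
Local Open Scope ring_scope.

Definition on_seg (R : realType) (z x y : R * R) : Prop :=
  exists t : R, 0 <= t /\ t <= 1 /\
    z.1 = (1 - t) * x.1 + t * y.1 /\ z.2 = (1 - t) * x.2 + t * y.2.

Definition Kn_geom_drawable (R : realType) (n k : nat) : Prop :=
  exists (p : 'I_n -> R * R) (c : 'I_n -> 'I_n -> 'I_k),
    injective p /\
    (forall i j v : 'I_n, (i < j)%N -> v != i -> v != j ->
        ~ on_seg R (p v) (p i) (p j)) /\
    (forall a b a' b' : 'I_n, (a < b)%N -> (a' < b')%N ->
        (a, b) != (a', b') -> c a b = c a' b' ->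
        forall z, on_seg R z (p a) (p b) -> on_seg R z (p a') (p b') ->
          (z = p a \/ z = p b) /\ (z = p a' \/ z = p b')).

(* theta(K_n) >= r  means: every admissible number of layers k is >= r
   (theta(K_n) is the least such k). *)
Definition geom_thickness_Kn_ge (R : realType) (n : nat) (r : R) : Prop :=
  forall k : nat, Kn_geom_drawable R n k -> r <= k%:R.

(* Main.v *)
Require Import Defs.
From HB Require Import structures.
From mathcomp Require Import all_boot all_order all_algebra.
From mathcomp Require Import reals.
From mathcomp Require Import ring lra zify.
Set Implicit Arguments.
Unset Strict Implicit.
Import Order.TTheory GRing.Theory Num.Theory.
Local Open Scope ring_scope.

(** Since every pair of points is joined by an edge, no three points are
    collinear. Choose the abscissa so that the lowest point b has at least x
    points on each side; let A (B) be the x leftmost (rightmost) points. The two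
    lower hull edges at b and the upper hull edge passing above b cross nothing
    and lie neither inside A nor inside B, so they may be added to every layer.

    In a layer E, every edge (u, v) which is not the lowest one at its right
    endpoint v bounds from above a wedge at v. Let m be the rightmost point before
    v in that wedge, and charge the edge to m "looking up", or to m "looking down"
    if m = u. Noncrossing makes the charge injective. Nothing is charged to the
    leftmost point or to the right endpoint of the upper hull edge looking up, nor,
    looking down, to a point without a right edge or to the left endpoint of a
    lower hull edge. A point of B with a right edge starts an edge inside B, and
    the edges outside A end outside A, so that at most 3n - 2x - 7 edges of the
    layer are neither inside A, nor inside B, nor one of the three hull edges.
    Summing over the layers bounds the number of layers when 2x < n; the case
    2x = n follows from x - 1. For the linear bound c, take x = floor (c + 1). *)

(** * Orientation signs, heights over a line and proper crossings *)

Definition orient (R : pzRingType) (a b c : R * R) : R :=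
  (b.1 - a.1) * (c.2 - a.2) - (b.2 - a.2) * (c.1 - a.1).

Definition crossing (R : numDomainType) (a b c d : R * R) : bool :=
  (orient a b c * orient a b d < 0) && (orient c d a * orient c d b < 0).

Section Orientation.
Variable R : realFieldType.
Implicit Types a b c d u v w z : R * R.

Lemma orient_swap a b c : orient a b c = - orient c b a.
Proof. by rewrite /orient; ring. Qed.

Lemma orient_swapl a b c : orient a b c = - orient b a c.
Proof. by rewrite /orient; ring. Qed.

Lemma orientx a b : orient a b a = 0.
Proof. by rewrite /orient; ring. Qed.

Lemma orientr a b : orient a b b = 0.
Proof. by rewrite /orient; ring. Qed.

(** Heights over the line [ab] are affine along the line [uv], so the height of [z] over [uv] is its
    height over [ab] minus the interpolation of those of [u] and [v]. *)
Lemma orient_affine a b u v z :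
  (b.1 - a.1) * orient u v z = (v.1 - u.1) * orient a b z
    - (v.1 - z.1) * orient a b u - (z.1 - u.1) * orient a b v.
Proof. by rewrite /orient; ring. Qed.

(* A positive multiple of the height of the line cd over the line ab at the
   abscissa of z, when a.1 < b.1 and c.1 < d.1. *)
Definition gap a b c d z :=
  orient a b z * (d.1 - c.1) - orient c d z * (b.1 - a.1).

(** The ordinate of [r] cancels in [gap], which leaves an affine function of the abscissa. *)
Lemma gap_affine a b c d r s t :
  gap a b c d r * (t.1 - s.1)
  = gap a b c d s * (t.1 - r.1) - gap a b c d t * (s.1 - r.1).
Proof. by rewrite /gap /orient; ring. Qed.

(** Being affine, the gap stays negative up to [s] and positive from [t] on. At an endpoint one of
    its two terms vanishes, so its signs there are the four signs of a crossing. *)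
Lemma gap_crossing a b c d s t :
  a.1 <= s.1 -> c.1 <= s.1 -> s.1 < t.1 -> t.1 <= b.1 -> t.1 <= d.1 ->
  gap a b c d s < 0 -> 0 < gap a b c d t -> crossing a b c d.
Proof.
move=> as_ cs st tb td gs gt.
have ab : 0 < b.1 - a.1 by lra.
have cd : 0 < d.1 - c.1 by lra.
have st0 : 0 < t.1 - s.1 by lra.
have left_neg r : r.1 <= s.1 -> gap a b c d r < 0.
  move=> rs; rewrite -(pmulr_llt0 _ st0) gap_affine.
  have : gap a b c d s * (t.1 - r.1) < 0 by rewrite pmulr_llt0 //; lra.
  have : 0 <= gap a b c d t * (s.1 - r.1).
    by apply: mulr_ge0; [exact: ltW | lra].
  lra.
have right_pos r : t.1 <= r.1 -> 0 < gap a b c d r.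
  move=> tr; rewrite -(pmulr_lgt0 _ st0) gap_affine.
  have : 0 <= - gap a b c d s * (r.1 - t.1).
    by apply: mulr_ge0; [rewrite oppr_ge0 ltW | lra].
  have : 0 < gap a b c d t * (r.1 - s.1) by rewrite mulr_gt0 //; lra.
  lra.
have := left_neg c cs; rewrite /gap orientx mul0r subr0 pmulr_llt0 // => oc.
have := right_pos d td; rewrite /gap orientr mul0r subr0 pmulr_lgt0 // => od.
have := left_neg a as_.
rewrite /gap orientx mul0r sub0r oppr_lt0 pmulr_lgt0 // => oa.
have := right_pos b tb.
rewrite /gap orientr mul0r sub0r oppr_gt0 pmulr_llt0 // => ob.
by rewrite /crossing nmulr_rlt0 // od pmulr_rlt0.
Qed.

End Orientation.

(** * Orientation signs and points of segments *)

Section Segments.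
Variable R : realType.
Implicit Types a b c d z : R * R.

Lemma on_segC z a b : on_seg R z a b -> on_seg R z b a.
Proof.
case=> t [t0 [t1 [e1 e2]]]; exists (1 - t); rewrite e1 e2.
by split; [lra | split; [lra | split; ring]].
Qed.

(** Along [ab] the orientation against [cd] is affine and changes sign, so it vanishes at some [z];
    it does not vanish at [a] or [b]. *)
Lemma crossing_meet a b c d : crossing a b c d ->
  exists z, [/\ on_seg R z a b, on_seg R z c d, z <> a & z <> b].
Proof.
case/andP; set C := orient a b c; set D := orient a b d => CD.
set A := orient c d a; set B := orient c d b => AB.
have AB0 : A - B != 0 by apply/eqP => h; have : A = B by [lra]; nra.
have CD0 : C - D != 0 by apply/eqP => h; have : C = D by [lra]; nra.
have unit01 (r s : R) : r * s < 0 -> 0 <= r / (r - s) /\ r / (r - s) <= 1.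
  move=> rs.
  have rs0 : r - s != 0 by apply/eqP => h; have : r = s by [lra]; nra.
  have sq : 0 < (r - s) ^+ 2 by rewrite exprn_even_gt0.
  have -> : r / (r - s) = r * (r - s) / (r - s) ^+ 2 by field.
  rewrite ler_pdivlMr // ler_pdivrMr //; split; nra.
have [A0 A1] := unit01 _ _ AB; have [C0 C1] := unit01 _ _ CD.
pose t := A / (A - B); pose s := C / (C - D).
pose z := ((1 - t) * a.1 + t * b.1, (1 - t) * a.2 + t * b.2).
have oz : orient c d z = 0.
  have -> : orient c d z = (1 - t) * A + t * B.
    by rewrite /z /A /B /orient /=; ring.
  by rewrite /t; field.
exists z; split.
- by exists t.
- exists s; split => //; split => //=.
  by split; rewrite /t /s; move: AB0 CD0; rewrite /A /B /C /D /orient => ? ?;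
    field; apply/andP.
- by move=> za; move: AB; rewrite /A -za oz mul0r ltxx.
- by move=> za; move: AB; rewrite /B -za oz mulr0 ltxx.
Qed.

Lemma collinear_on_seg a b c : a <> b -> orient a b c = 0 ->
  [\/ on_seg R c a b, on_seg R a b c | on_seg R b a c].
Proof.
move=> ab o0.
pose u := b.1 - a.1; pose v := b.2 - a.2.
have q0 : 0 < u ^+ 2 + v ^+ 2.
  rewrite lt_neqAle addr_ge0 ?sqr_ge0 // andbT eq_sym paddr_eq0 ?sqr_ge0 //.
  rewrite !sqrf_eq0 !subr_eq0; apply/andP => -[/eqP h1 /eqP h2]; apply: ab.
  by rewrite [a]surjective_pairing [b]surjective_pairing h1 h2.
have q1 : u ^+ 2 + v ^+ 2 != 0 by rewrite gt_eqF.
(* The parameter of the orthogonal projection of [c] on the line [ab]; comparing it with 0 and 1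
   tells which point is the middle one. *)
pose t := ((c.1 - a.1) * u + (c.2 - a.2) * v) / (u ^+ 2 + v ^+ 2).
have c1 : c.1 = (1 - t) * a.1 + t * b.1.
  apply/eqP; rewrite -subr_eq0.
  have -> : c.1 - ((1 - t) * a.1 + t * b.1)
      = - v * orient a b c / (u ^+ 2 + v ^+ 2).
    by rewrite /t /orient; move: q1; rewrite /u /v => ?; field.
  by rewrite o0 mulr0 mul0r.
have c2 : c.2 = (1 - t) * a.2 + t * b.2.
  apply/eqP; rewrite -subr_eq0.
  have -> : c.2 - ((1 - t) * a.2 + t * b.2)
      = u * orient a b c / (u ^+ 2 + v ^+ 2).
    by rewrite /t /orient; move: q1; rewrite /u /v => ?; field.
  by rewrite o0 mulr0 mul0r.
move: t c1 c2 => t c1 c2.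
have [t0|t0] := ltP t 0.
  have t1 : 1 - t != 0 by rewrite gt_eqF //; lra.
  apply: Or32; exists (1 / (1 - t)).
  rewrite ler_pdivlMr ?ler_pdivrMr; try lra.
  do 2 (split; first lra).
  by split; rewrite ?c1 ?c2; field.
have [t1|t1] := leP t 1; first by apply: Or31; exists t.
have t2 : t != 0 by rewrite gt_eqF //; lra.
apply: Or33; exists (1 / t).
rewrite ler_pdivlMr ?ler_pdivrMr; try lra.
do 2 (split; first lra).
by split; rewrite ?c1 ?c2; field.
Qed.

End Segments.

(** * Cardinality tools *)

(** Stated for a relation because the slot charged by an edge is only known to exist. *)
Lemma leq_card_rel (S T : finType) (A : {set S}) (B : {set T})
    (P : S -> T -> Prop) :
  (forall s, s \in A -> exists2 t, t \in B & P s t) ->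
  (forall s s' t, P s t -> P s' t -> s = s') ->
  (#|A| <= #|B|)%N.
Proof.
move=> total inj.
have [->|[s0 /total[t0 _ _]]] := set_0Vmem A; first by rewrite cards0.
have [f fP] : exists f, forall s, s \in A -> f s \in B /\ P s (f s).
  apply: (fin_all_exists (P := fun s t => s \in A -> t \in B /\ P s t)) => s.
  have [/total[t tB st]|_] := boolP (s \in A); last by exists t0.
  by exists t.
rewrite -(card_in_imset (f := f)); last first.
  by move=> s s' /fP[_ st] /fP[_ +] E; rewrite -E; apply: inj st.
by apply/subset_leq_card/subsetP => _ /imsetP[s /fP[fsB _] ->].
Qed.

Lemma card_ord_geq n k : #|[set i : 'I_n | (k <= i)%N]| = (n - k)%N.
Proof.
rewrite -sum1dep_card -(big_mkord (fun i => k <= i)%N (fun=> 1%N)).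
by rewrite -(big_nat_widenl k 0 n predT) // sum_nat_const_nat muln1.
Qed.

(** * Wedges in one layer and the charging of its edges *)

Section Wedges.
Variables (R : realFieldType) (n : nat) (p : 'I_n -> R * R).
Variable E : {set 'I_n * 'I_n}.
Notation o i j k := (orient (p i) (p j) (p k)).

Hypothesis p_incr : forall i j : 'I_n, (i < j)%N -> (p i).1 < (p j).1.
Hypothesis o_neq0 : forall i j k : 'I_n,
  i != j -> j != k -> i != k -> o i j k != 0.
Hypothesis E_lt : forall u v : 'I_n, (u, v) \in E -> (u < v)%N.
Hypothesis E_nocross : forall a b c d : 'I_n,
  (a, b) \in E -> (c, d) \in E -> ~~ crossing (p a) (p b) (p c) (p d).

Let p_incr_le (i j : 'I_n) : (i <= j)%N -> (p i).1 <= (p j).1.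
Proof.
by rewrite leq_eqVlt => /orP[/eqP/val_inj-> //|/p_incr/ltW].
Qed.

Let lt_neq (i j : 'I_n) : (i < j)%N -> i != j.
Proof. by move=> ij; rewrite -val_eqE ltn_eqF. Qed.

Lemma gap_nocross (a b c d s t : 'I_n) : (a, b) \in E -> (c, d) \in E ->
  (a <= s)%N -> (c <= s)%N -> (s < t)%N -> (t <= b)%N -> (t <= d)%N ->
  gap (p a) (p b) (p c) (p d) (p s) < 0 ->
  0 < gap (p a) (p b) (p c) (p d) (p t) -> False.
Proof.
move=> abE cdE as_ cs st tb td gs gt; have /negP[] := E_nocross abE cdE.
by apply: gap_crossing gs gt; (exact: p_incr) || exact: p_incr_le.
Qed.

(* The edge (w, v) comes right after (u, v), downwards, among the edges of E
   with right endpoint v, and m is the rightmost vertex before v in the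
   closed wedge between them. *)
Definition wedge (u w v m : 'I_n) : Prop :=
  [/\ [/\ (u, v) \in E, (w, v) \in E & o u v w < 0],
      forall z, (z, v) \in E -> o u v z < 0 -> o w v z <= 0,
      [/\ (u <= m)%N, (w <= m)%N & (m < v)%N],
      o u v m <= 0 /\ 0 <= o w v m &
      forall m' : 'I_n, (m < m')%N -> (m' < v)%N ->
        0 < o u v m' \/ o w v m' < 0].

(** As [v] lies between [m] and [v'], maximality of [m] puts [v] outside the wedge at [v'], beyond
    one of its two edges. That edge then crosses the opposite edge of the wedge at [v] between [m]
    and [v]; [strict] excludes a mere contact at [m]. *)
Lemma wedge_apex_unique u w v u' w' v' m :
  wedge u w v m -> wedge u' w' v' m -> (v < v')%N ->
  (o u v m < 0 /\ o u' v' m < 0) \/ (0 < o w v m /\ 0 < o w' v' m) -> False.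
Proof.
move=> [[uvE wvE _] _ [um wm mv] [mhi mlo] _].
move=> [[uvE' wvE' _] _ [um' wm' mv'] [mhi' mlo'] mmax] vv' strict.
have px_lt a b : (a, b) \in E -> 0 < (p b).1 - (p a).1.
  by move=> /E_lt/p_incr; rewrite subr_gt0.
have [huv hwv huv' hwv'] : [/\ 0 < (p v).1 - (p u).1, 0 < (p v).1 - (p w).1,
    0 < (p v').1 - (p u').1 & 0 < (p v').1 - (p w').1] by split; apply: px_lt.
have [hi|lo] := mmax _ mv vv'.
- apply: (gap_nocross (s := m) (t := v) uvE' wvE) => //;
    rewrite ?(ltnW vv') // /gap.
  + by case: strict => -[? ?]; nra.
  + by rewrite orientr mul0r subr0 mulr_gt0.
- apply: (gap_nocross (s := m) (t := v) uvE wvE') => //;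
    rewrite ?(ltnW vv') // /gap.
  + by case: strict => -[? ?]; nra.
  + by rewrite orientr mul0r sub0r oppr_gt0 pmulr_llt0.
Qed.

(** The edge [(u, v)] is below [(u', v)], hence not above its successor [(w', v)]; but [m] is on or
    above the latter and strictly below the former. *)
Lemma wedge_top_unique u w u' w' v m :
  wedge u w v m -> wedge u' w' v m -> o u v m < 0 -> o u' v u < 0 -> False.
Proof.
move=> [[uvE _ _] _ [_ _ mv] _ _] [[_ wvE' _] nxt _ [_ mlo] _] mhi uu'.
have := nxt _ uvE uu' => uw'.
have := orient_affine (p w') (p v) (p u) (p v) (p m).
rewrite orientr mulr0 subr0.
have /p_incr uv := E_lt uvE; have /p_incr wv := E_lt wvE'.
have {}mv := p_incr mv.
by nra.
Qed.

(** Looking up, [m] is strictly below the upper edge; looking down, [m = u] is strictly above the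
    lower edge. Equal looks thus give both wedges the same strict side, which forces equal
    apices. *)
Lemma wedge_slot_inj u w v u' w' v' m :
  wedge u w v m -> wedge u' w' v' m -> (m == u) = (m == u') ->
  (u, v) = (u', v').
Proof.
have below : forall a b c k, wedge a b c k -> k != a -> o a c k < 0.
  move=> a b c k [[acE _ _] _ [_ _ kc] [khi _] _] ka.
  rewrite lt_neqAle khi andbT.
  have ac := lt_neq (E_lt acE).
  by apply: o_neq0; rewrite // eq_sym //; apply: lt_neq.
have above : forall i j k, wedge i j k i -> 0 < o j k i.
  by move=> i j k [[_ _ ijk] _ _ _ _]; rewrite orient_swap oppr_gt0.
move=> W W' mm.
have strict : (o u v m < 0 /\ o u' v' m < 0) \/ (0 < o w v m /\ 0 < o w' v' m).
  have [mu|mu] := eqVneq m u; last first.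
    left; split; first exact: (below _ w).
    by apply: (below _ w') => //; rewrite -mm.
  have /eqP mu' : m == u' by rewrite -mm mu.
  by right; move: W W'; rewrite -mu -mu' => /above ? /above.
have vv' : v = v'.
  apply/val_inj; case: (ltngtP v v') => // vv'.
  - by case: (wedge_apex_unique W W' vv').
  - by case: (wedge_apex_unique W' W vv'); case: strict => -[]; [left|right].
subst v'; congr (_, _); apply/eqP/negPn/negP => uu'.
have mu : m != u.
  apply/negP => mu; move: uu'; rewrite -(eqP mu).
  by move: mu; rewrite mm => ->.
have mu' : m != u' by rewrite -mm.
have [[[uvE _ _] _ _ _ _] [[uvE' _ _] _ _ _ _]] := (W, W').
have : o u' v u != 0.
  have /lt_neq uv := E_lt uvE; have /lt_neq uv' := E_lt uvE'.
  by apply: o_neq0; rewrite // eq_sym.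
rewrite neq_lt => /orP[lt|gt].
- exact: wedge_top_unique W W' (below _ _ _ _ W mu) lt.
- apply: wedge_top_unique W' W (below _ _ _ _ W' mu') _.
  by rewrite orient_swap oppr_lt0.
Qed.

Definition lowest_edges :=
  [set e in E | [forall z, ((z, e.2) \in E) ==> (0 <= o e.1 e.2 z)]].

Lemma wedge_exists u v : (u, v) \in E :\: lowest_edges ->
  exists w m, wedge u w v m.
Proof.
rewrite !inE /= => /andP[+ uvE]; rewrite uvE /= => /forallPn[z0].
rewrite negb_imply -ltNge => /andP[z0vE z0lo].
pose P z := ((z, v) \in E) && (o u v z < 0).
(* The opposite of the usual slope: left of [v], a larger value means a higher edge. *)
pose slope z := ((p z).2 - (p v).2) / ((p v).1 - (p z).1).
have Pz0 : P z0 by apply/andP.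
case: (@arg_maxP _ _ _ z0 P slope Pz0) => w /andP[wvE wlo] wmax.
have next z : (z, v) \in E -> o u v z < 0 -> o w v z <= 0.
  move=> zvE zlo; have : slope z <= slope w by apply: wmax; rewrite /P zvE.
  have /p_incr zv := E_lt zvE; have /p_incr wv := E_lt wvE.
  rewrite /slope ler_pdivrMr ?subr_gt0 // mulrAC ler_pdivlMr ?subr_gt0 //.
  by rewrite /orient; lra.
pose Q (m : 'I_n) :=
  [&& (u <= m)%N, (w <= m)%N, (m < v)%N, o u v m <= 0 & 0 <= o w v m].
(* The wedge is inhabited by the one of [u] and [w] further to the right. *)
have [m0 Qm0] : exists m, Q m.
  case: (leqP u w) => [uw|/ltnW wu].
    by exists w; rewrite /Q uw leqnn (E_lt wvE) orientx lexx (ltW wlo).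
  exists u; rewrite /Q wu leqnn (E_lt uvE) orientx lexx.
  by rewrite orient_swap oppr_ge0 (ltW wlo).
case: (@arg_maxnP _ m0 Q (fun m => m : nat) Qm0) => m.
move=> /and5P[um wm mv mhi mlo] mmax.
exists w, m; split => //.
move=> m' mm' m'v; case: ltP => m'hi; first by left.
right; rewrite ltNge; apply/negP => m'lo.
have := mmax m'; rewrite /Q (leq_trans um) ?(leq_trans wm) ?(ltnW mm') //.
by rewrite m'v m'hi m'lo => /(_ isT); rewrite /= leqNgt mm'.
Qed.

Definition nonsinks := [set u | [exists v, (u, v) \in E]].

Lemma nonsinks_edge u v : (u, v) \in E -> u \in nonsinks.
Proof. by move=> uvE; rewrite inE; apply/existsP; exists v. Qed.

(** No chord passes strictly below [a], which lies on a lower supporting line, whereas the lower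
    edge of a wedge passes strictly below a point looking down. *)
Lemma lower_hull_wedge (a b w v m : 'I_n) :
  (a < b)%N -> (forall k, 0 <= o a b k) ->
  wedge m w v m -> m != a.
Proof.
move=> /p_incr ab hull [[mvE wvE lo] _ [_ wm mv] _ _].
apply/eqP => ma; subst a.
have := orient_affine (p m) (p b) (p w) (p v) (p m).
have := hull w; have := hull v; rewrite orientx mulr0 sub0r.
have {}mv := p_incr mv; have {}wm := p_incr_le wm.
have : 0 < o w v m by rewrite orient_swap oppr_gt0.
by nra.
Qed.

Lemma upper_hull_wedge (a b u w v m : 'I_n) :
  (a < b)%N -> (forall k, o a b k <= 0) ->
  wedge u w v m -> o u v m < 0 -> m != b.
Proof.
move=> /p_incr ab hull [[uvE _ _] _ [um _ mv] _ _] lo.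
apply/eqP => mb; subst b.
have := orient_affine (p a) (p m) (p u) (p v) (p m).
have := hull u; have := hull v; rewrite orientr mulr0 sub0r.
have {}mv := p_incr mv; have {}um := p_incr_le um.
by nra.
Qed.

(** * The bound for a layer that contains the three hull edges *)

Section Hull.
Variables a b c l r : 'I_n.
Hypothesis abE : (a, b) \in E.
Hypothesis bcE : (b, c) \in E.
Hypothesis lrE : (l, r) \in E.
Hypothesis ab_lower : forall k, 0 <= o a b k.
Hypothesis bc_lower : forall k, 0 <= o b c k.
Hypothesis lr_upper : forall k, o l r k <= 0.

(** There are [n - 2] slots looking up, all but [i0] and [r], and [#|nonsinks| - 2] looking down,
    all but [a] and [b]. *)
Lemma card_not_lowest : (#|E :\: lowest_edges| + 4 <= n + #|nonsinks|)%N.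
Proof.
pose i0 : 'I_n := Ordinal (leq_ltn_trans (leq0n a) (ltn_ord a)).
pose ups := ~: [set i0; r]; pose downs := nonsinks :\ a :\ b.
pose slots := [set (m, false) | m in ups] :|: [set (m, true) | m in downs].
have le_slots : (#|E :\: lowest_edges| <= #|slots|)%N.
  apply: (leq_card_rel (P := fun e s =>
    exists w, exists2 m, wedge e.1 w e.2 m & s = (m, m == e.1))); last first.
    move=> [u v] [u' v'] s [w [m W ->]] [w' [m' W' [mm' mu]]]; subst m'.
    exact: wedge_slot_inj W W' mu.
  move=> [u v] /wedge_exists[w [m W]].
  exists (m, m == u); last by exists w, m.
  have [mu|mu] := eqVneq m u.
    subst u; rewrite inE; apply/orP; right; apply: imset_f.
    rewrite !inE (lower_hull_wedge (E_lt abE) ab_lower W).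
    rewrite (lower_hull_wedge (E_lt bcE) bc_lower W) /=.
    by case: W => -[mvE _ _] _ _ _ _; have := nonsinks_edge mvE; rewrite inE.
  rewrite inE; apply/orP; left; apply: imset_f.
  have [[uvE _ _] _ [um wm mv] [mhi _] _] := W.
  have ltum : (u < m)%N by rewrite ltn_neqAle um eq_sym val_eqE mu.
  have mlo : o u v m < 0.
    rewrite lt_neqAle mhi andbT; apply: o_neq0; first exact: lt_neq (E_lt uvE).
      by rewrite eq_sym lt_neq.
    exact: lt_neq.
  rewrite !inE negb_or (upper_hull_wedge (E_lt lrE) lr_upper W mlo) andbT.
  by rewrite -val_eqE /= -lt0n (leq_ltn_trans _ ltum).
have i0r : i0 != r.
  by rewrite -val_eqE /= eq_sym -lt0n (leq_ltn_trans _ (E_lt lrE)).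
have cU := cardsC [set i0; r]; rewrite cards2 i0r card_ord in cU.
have cA := cardsD1 a nonsinks; rewrite (nonsinks_edge abE) in cA.
have cB := cardsD1 b (nonsinks :\ a).
rewrite in_setD1 (nonsinks_edge bcE) andbT eq_sym (lt_neq (E_lt abE)) in cB.
have le_ups : (#|[set (m, false) | m in ups]| <= #|ups|)%N.
  exact: leq_imset_card.
have le_downs : (#|[set (m, true) | m in downs]| <= #|downs|)%N.
  exact: leq_imset_card.
have : (#|slots| <= #|ups| + #|downs|)%N.
  by apply: leq_trans (leq_card_setU _ _) _; apply: leq_add.
by rewrite /ups /downs in le_slots *; lia.
Qed.

Lemma lowest_inj : {in lowest_edges &, injective snd}.
Proof.
move=> [u v] [u' v'] /= + + vv'; subst v'.
rewrite !inE => /andP[uvE /forallP lo] /andP[uvE' /forallP lo'].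
have := lo u'; have := lo' u; rewrite /= uvE uvE' /= => h1 h2.
congr (_, _); apply/eqP/negPn/negP => uu'.
have /lt_neq uv := E_lt uvE; have /lt_neq uv' := E_lt uvE'.
have /negP[] : o u v u' != 0 by apply: o_neq0; rewrite // eq_sym.
by rewrite eq_le h2 andbT orient_swap oppr_le0.
Qed.

(** Edges ending outside the first [x] points number at most [(n + #|nonsinks| - 4) + (n - x)]. At
    least [x + #|nonsinks| - n] of them start among the last [x] points, and [#|nonsinks|] cancels
    in the difference. *)
Lemma layer_bound x : (x <= b)%N -> (b < n - x)%N ->
  (#|[set e in E | (x <= e.2) && (e.1 < n - x)]| + 2 * x + 4 <= 3 * n)%N.
Proof.
move=> xb bx.
pose right := [set e in E | (x <= e.2)%N].
pose inB := [set e in E | (n - x <= e.1)%N].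
pose low := [set e in lowest_edges | (x <= e.2)%N].
set Q := finset _.
have right_le : (#|right| <= #|E :\: lowest_edges| + #|low|)%N.
  apply: leq_trans (leq_card_setU _ _); apply/subset_leq_card/subsetP => e.
  rewrite inE => /andP[eE xe]; have [el|el] := boolP (e \in lowest_edges).
    by rewrite inE; apply/orP; right; rewrite inE el xe.
  by rewrite inE; apply/orP; left; rewrite in_setD el eE.
have low_le : (#|low| <= n - x)%N.
  rewrite -card_ord_geq -(card_in_imset (f := snd)); last first.
    move=> e e'; rewrite ![_ \in low]inE => /andP[? _] /andP[? _].
    exact: lowest_inj.
  apply/subset_leq_card/subsetP => _ /imsetP[e + ->].
  by rewrite !inE => /andP[].
have right_eq : #|right| = (#|Q| + #|inB|)%N.
  rewrite -(cardsID inB right) addnC; congr (_ + _)%N; apply: eq_card => -[u v];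
    rewrite !inE /=; have [/E_lt uv|//] := boolP ((u, v) \in E);
    rewrite ?andbF //=.
    by rewrite -ltnNge andbC.
  by lia.
have inB_ge : (#|[set i : 'I_n | (n - x <= i)%N] :&: nonsinks| <= #|inB|)%N.
  apply: leq_trans (leq_imset_card fst _).
  apply/subset_leq_card/subsetP => u; rewrite 2!inE => /andP[xu].
  rewrite inE => /existsP[v uvE].
  by apply/imsetP; exists (u, v); rewrite // inE uvE.
have := cardsUI [set i : 'I_n | (n - x <= i)%N] nonsinks.
have : (#|[set i : 'I_n | (n - x <= i)%N] :|: nonsinks| <= n)%N.
  by rewrite -[leqRHS]card_ord max_card.
rewrite card_ord_geq; have := card_not_lowest; lia.
Qed.

End Hull.
End Wedges.

(** * Pairs inside an initial or a final block of indices *)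

Lemma card_pairs_lt n x : (x <= n)%N ->
  #|[set e : 'I_n * 'I_n | (e.1 < e.2 < x)%N]| = 'C(x, 2).
Proof.
move=> xn; rewrite -sum1dep_card.
rewrite -(pair_big_dep predT (fun i j : 'I_n => i < j < x)%N
  (fun _ _ => 1%N)) /=.
rewrite (exchange_big_dep (fun j : 'I_n => j < x)%N) /=; last first.
  by move=> i j _ /andP[].
transitivity (\sum_(j < n | (j < x)%N) j)%N.
  apply: eq_bigr => j jx; under eq_bigl => i do rewrite jx andbT.
  rewrite sum1dep_card.
  have := cardsC [set i : 'I_n | (j <= i)%N]; rewrite card_ord card_ord_geq.
  have -> : ~: [set i : 'I_n | (j <= i)%N] = [set i : 'I_n | (i < j)%N].
    by apply/setP => i; rewrite !inE ltnNge.
  move=> cards; apply/eqP; rewrite -(eqn_add2l (n - j)%N); apply/eqP.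
  by rewrite subnK ?(ltnW (ltn_ord j)).
rewrite -bin2_sum -(big_mkord (fun j => j < x)%N id).
by rewrite (big_nat_widen 0 x n).
Qed.

Lemma card_pairs_ge n x : (x <= n)%N ->
  (#|[set e : 'I_n * 'I_n | (e.1 < e.2)%N && (n - x <= e.1)%N]| <= 'C(x, 2))%N.
Proof.
move=> xn; rewrite -(card_pairs_lt xn).
pose f (e : 'I_n * 'I_n) := (rev_ord e.2, rev_ord e.1).
rewrite -(card_imset _ (f := f)); last first.
  move=> [i j] [i' j'] E.
  have /rev_ord_inj /= -> := congr1 fst E.
  by have /rev_ord_inj /= -> := congr1 snd E.
apply/subset_leq_card/subsetP => _ /imsetP[[i j] + ->].
rewrite !inE /= => /andP[ij xi].
by have := ltn_ord j; have := ltn_ord i; lia.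
Qed.

(** * Hull edges of a sorted drawing and the sum over the layers *)

Section SortedDrawing.
Variables (R : realFieldType) (n k : nat) (p : 'I_n -> R * R).
Variable col : 'I_n -> 'I_n -> 'I_k.
Notation o i j k := (orient (p i) (p j) (p k)).

Hypothesis p_incr : forall i j : 'I_n, (i < j)%N -> (p i).1 < (p j).1.
Hypothesis o_neq0 : forall i j k : 'I_n,
  i != j -> j != k -> i != k -> o i j k != 0.
Hypothesis col_nocross : forall a b c d : 'I_n, (a < b)%N -> (c < d)%N ->
  col a b = col c d -> ~~ crossing (p a) (p b) (p c) (p d).
Variable b : 'I_n.
Hypothesis b_lowest : forall m, m != b -> (p b).2 < (p m).2.

(** The largest slope towards [b] settles the points before [b]. The line [ab] descends to the
    lowest point, hence stays below all points after it. *)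
Lemma lower_hull_left : (0 < b)%N ->
  exists2 a : 'I_n, (a < b)%N & forall m, 0 <= o a b m.
Proof.
move=> b0; pose i0 : 'I_n := Ordinal (ltn_trans b0 (ltn_ord b)).
pose slope i := ((p b).2 - (p i).2) / ((p b).1 - (p i).1).
case: (@arg_maxP _ _ _ i0 (fun i : 'I_n => i < b)%N slope b0) => a ab amax.
exists a => // m; have /p_incr Xab := ab.
have Yab : (p b).2 < (p a).2 by apply: b_lowest; rewrite -val_eqE ltn_eqF.
have [mb|bm|/val_inj->] := ltngtP m b; last by rewrite orientr.
- have : slope m <= slope a by apply: amax.
  have Xmb := p_incr mb.
  rewrite /slope ler_pdivrMr ?subr_gt0 // mulrAC ler_pdivlMr ?subr_gt0 //.
  by rewrite /orient; lra.
- have Xbm := p_incr bm.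
  have Ybm : (p b).2 < (p m).2 by apply: b_lowest; rewrite -val_eqE gtn_eqF.
  rewrite /orient; nra.
Qed.

Lemma lower_hull_right : (b < n.-1)%N ->
  exists2 c : 'I_n, (b < c)%N & forall m, 0 <= o b c m.
Proof.
move=> bn; have n0 : (n.-1 < n)%N by have := ltn_ord b; lia.
pose i0 : 'I_n := Ordinal n0.
pose slope i := ((p i).2 - (p b).2) / ((p i).1 - (p b).1).
case: (@arg_minP _ _ _ i0 (fun i : 'I_n => b < i)%N slope bn) => c bc cmin.
exists c => // m; have /p_incr Xbc := bc.
have Ybc : (p b).2 < (p c).2 by apply: b_lowest; rewrite -val_eqE gtn_eqF.
have [mb|bm|/val_inj->] := ltngtP m b; last by rewrite orientx.
- have Xmb := p_incr mb.
  have Ybm : (p b).2 < (p m).2 by apply: b_lowest; rewrite -val_eqE ltn_eqF.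
  rewrite /orient; nra.
- have : slope c <= slope m by apply: cmin.
  have Xbm := p_incr bm.
  rewrite /slope ler_pdivrMr ?subr_gt0 // mulrAC ler_pdivlMr ?subr_gt0 //.
  by rewrite /orient; lra.
Qed.

(** Among the segments passing over [b], take the highest one there: a point above its line could
    replace the endpoint on the same side and raise it. *)
Lemma upper_hull_bridge : (0 < b)%N -> (b < n.-1)%N ->
  exists l r : 'I_n, [/\ (l < b)%N, (b < r)%N & forall m, o l r m <= 0].
Proof.
move=> b0 bn; have n0 : (n.-1 < n)%N by have := ltn_ord b; lia.
pose e0 : 'I_n * 'I_n := (Ordinal (ltn_trans b0 (ltn_ord b)), Ordinal n0).
(* The ordinate of the segment at the abscissa of [b]. *)
pose height (e : 'I_n * 'I_n) :=
  ((p e.1).2 * ((p e.2).1 - (p b).1) + (p e.2).2 * ((p b).1 - (p e.1).1))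
    / ((p e.2).1 - (p e.1).1).
pose P (e : 'I_n * 'I_n) := (e.1 < b < e.2)%N.
have Pe0 : P e0 by apply/andP.
case: (@arg_maxP _ _ _ e0 P height Pe0) => -[l r] /= /andP[/= lb br] lrmax.
exists l, r; split=> // m.
have /p_incr Xlb := lb; have /p_incr Xbr := br.
have [mb|bm|/val_inj->] := ltngtP m b.
- have : height (m, r) <= height (l, r) by apply: lrmax; rewrite /P mb.
  have Xmb := p_incr mb.
  rewrite /height /= ler_pdivrMr ?subr_gt0; last by lra.
  rewrite mulrAC ler_pdivlMr ?subr_gt0; last by lra.
  rewrite -subr_le0.
  set lhs := (X in X <= 0).
  have -> : lhs = ((p r).1 - (p b).1) * o l r m.
    by rewrite /lhs /orient; ring.
  by rewrite pmulr_rle0 // subr_gt0.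
- have : height (l, m) <= height (l, r) by apply: lrmax; rewrite /P lb.
  have Xbm := p_incr bm.
  rewrite /height /= ler_pdivrMr ?subr_gt0; last by lra.
  rewrite mulrAC ler_pdivlMr ?subr_gt0; last by lra.
  rewrite -subr_le0.
  set lhs := (X in X <= 0).
  have -> : lhs = ((p b).1 - (p l).1) * o l r m.
    by rewrite /lhs /orient; ring.
  by rewrite pmulr_rle0 // subr_gt0.
- have Yl : (p b).2 < (p l).2 by apply: b_lowest; rewrite -val_eqE ltn_eqF.
  have Yr : (p b).2 < (p r).2 by apply: b_lowest; rewrite -val_eqE gtn_eqF.
  rewrite /orient; nra.
Qed.

Lemma sorted_bound x : (0 < x)%N -> (x <= b)%N -> (b < n - x)%N ->
  ('C(n, 2) <= 2 * 'C(x, 2) + 3 + k * (3 * n - (2 * x + 7)))%N.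
Proof.
move=> x0 xb bx.
have b0 : (0 < b)%N by lia.
have bn : (b < n.-1)%N by lia.
have xn : (x <= n)%N by lia.
have [a ab ab_lower] := lower_hull_left b0.
have [c bc bc_lower] := lower_hull_right bn.
have [l [r [lb br lr_upper]]] := upper_hull_bridge b0 bn.
pose H : {set 'I_n * 'I_n} := [set (a, b); (b, c); (l, r)].
have HP e : e \in H -> [/\ (e.1 < e.2)%N, (x <= e.2)%N, (e.1 < n - x)%N &
    (forall m, 0 <= o e.1 e.2 m) \/ (forall m, o e.1 e.2 m <= 0)].
  rewrite !inE => /orP[/orP[]|] /eqP-> /=; split=> //; try lia.
  - by left.
  - by left.
  - by right.
(* The bridge has its ends on both sides of [b], while each lower edge has [b] as an end. *)
have H3 : #|H| = 3.
  rewrite /H -setUA !cardsU1 cards1 !inE !xpair_eqE -!val_eqE /=; lia.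
have H_nocross e : e \in H -> forall f : 'I_n * 'I_n,
    ~~ crossing (p e.1) (p e.2) (p f.1) (p f.2) /\
    ~~ crossing (p f.1) (p f.2) (p e.1) (p e.2).
  move=> /HP[_ _ _ side] f; rewrite /crossing !negb_and -!leNgt.
  suff h : 0 <= o e.1 e.2 f.1 * o e.1 e.2 f.2 by rewrite h orbT.
  by case: side => side; [apply: mulr_ge0 | apply: mulr_le0].
pose pairs : {set 'I_n * 'I_n} := [set e : 'I_n * 'I_n | (e.1 < e.2)%N].
pose Q := [set e in pairs | [&& (x <= e.2)%N, (e.1 < n - x)%N & e \notin H]].
pose layer t := [set e in Q | col e.1 e.2 == t].
have layer_le t : (#|layer t| <= 3 * n - (2 * x + 7))%N.
  (* The colour class enlarged by all three hull edges, whatever their colours; removing them again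
     turns the 4 of [layer_bound] into 7. *)
  pose E := [set e in pairs | col e.1 e.2 == t] :|: H.
  have E_lt u v : (u, v) \in E -> (u < v)%N.
    by rewrite in_setU => /orP[|/HP[]//]; rewrite !inE => /andP[].
  have E_nocross u v u' v' : (u, v) \in E -> (u', v') \in E ->
      ~~ crossing (p u) (p v) (p u') (p v').
    move=> /setUP[e1|eH]; last by have [] := H_nocross _ eH (u', v').
    move=> /setUP[e2|eH]; last by have [] := H_nocross _ eH (u, v).
    move: e1 e2; rewrite !inE => /andP[/= uv /eqP c1] /andP[/= uv' /eqP c2].
    by apply: col_nocross; rewrite ?c1 ?c2.
  have HE e : e \in H -> e \in E by move=> eH; rewrite in_setU eH orbT.
  have abE : (a, b) \in E by apply: HE; rewrite !inE eqxx.
  have bcE : (b, c) \in E by apply: HE; rewrite !inE eqxx orbT.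
  have lrE : (l, r) \in E by apply: HE; rewrite !inE eqxx orbT.
  have := layer_bound p_incr o_neq0 E_lt E_nocross abE bcE lrE
    ab_lower bc_lower lr_upper xb bx.
  have disj : layer t :&: H = set0.
    apply/setP => e; rewrite [RHS]inE; apply/negP => /setIP[].
    by rewrite 2!inE => /andP[/andP[_ /and3P[_ _ /negP]]].
  have := cardsUI (layer t) H; rewrite disj cards0 H3 addn0.
  have : (#|layer t :|: H| <=
      #|[set e in E | (x <= e.2) && (e.1 < n - x)]|)%N.
    apply/subset_leq_card/subsetP => e; rewrite in_setU => /orP[eL|eH].
      move: eL; rewrite 3!inE => /andP[/andP[ep /and3P[xe ex _]] ct].
      by rewrite inE xe ex in_setU inE ep ct.
    by have [_ xe ex _] := HP _ eH; rewrite inE xe ex HE.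
  lia.
have Q_le : (#|Q| <= k * (3 * n - (2 * x + 7)))%N.
  rewrite -sum1_card (partition_big (fun e => col e.1 e.2) predT) //=.
  rewrite -[in leqRHS](card_ord k) -sum_nat_const; apply: leq_sum => t _.
  rewrite sum1dep_card; apply: leq_trans (layer_le t).
  by apply: subset_leq_card; apply/subsetP => e; rewrite !inE.
pose A2 := [set e : 'I_n * 'I_n | (e.1 < e.2 < x)%N].
pose B2 := [set e : 'I_n * 'I_n | (e.1 < e.2)%N && (n - x <= e.1)%N].
have pairs_card : #|pairs| = 'C(n, 2).
  rewrite -(card_pairs_lt (leqnn n)); apply: eq_card => e.
  by rewrite !inE ltn_ord andbT.
have : (#|pairs| <= #|Q :|: H :|: (A2 :|: B2)|)%N.
  apply/subset_leq_card/subsetP => e ep.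
  have e12 : (e.1 < e.2)%N by move: ep; rewrite inE.
  have [eH|eH] := boolP (e \in H).
    by apply/setUP; left; apply/setUP; right.
  have [xe|xe] := ltnP e.2 x.
    by apply/setUP; right; apply/setUP; left; rewrite inE e12.
  have [ex|ex] := leqP (n - x) e.1.
    by apply/setUP; right; apply/setUP; right; rewrite inE e12.
  by apply/setUP; left; apply/setUP; left; rewrite inE ep xe ex eH.
have [UQ _] := leq_card_setU Q H; have [UA _] := leq_card_setU A2 B2.
have [U _] := leq_card_setU (Q :|: H) (A2 :|: B2).
have A2_card : #|A2| = 'C(x, 2) by apply: card_pairs_lt.
have B2_le : (#|B2| <= 'C(x, 2))%N by apply: card_pairs_ge.
rewrite -pairs_card => /leq_trans; apply; apply: leq_trans U _.
apply: leq_trans (leq_add UQ UA) _; rewrite A2_card H3.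
by move: Q_le B2_le; set total := (k * _)%N; lia.
Qed.

End SortedDrawing.

(** * Choice of coordinates and sorting *)

Lemma exists_between_notin (R : realFieldType) (s : seq R) (lo hi : R) :
  lo < hi -> exists2 t, lo < t < hi & t \notin s.
Proof.
elim: s hi => [|y s IH] hi lohi.
  by exists ((lo + hi) / 2) => //; apply/andP; split; lra.
have [/andP[loy yhi]|ny] := boolP (lo < y < hi).
  have [t /andP[lot ty] ts] := IH _ loy.
  by exists t; rewrite ?lot ?(lt_trans ty) // inE negb_or lt_eqF.
have [t lth ts] := IH _ lohi; exists t => //.
by rewrite inE negb_or ts andbT; apply: contraNneq ny => <-.
Qed.

Lemma exists_initial_subset (R : realFieldType) (I : finType) (f : I -> R)
    (S : {set I}) k : {in S &, injective f} -> (k <= #|S|)%N ->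
  exists2 T : {set I}, T \subset S /\ #|T| = k &
    {in T & S :\: T, forall i j, f i < f j}.
Proof.
move=> f_inj; elim: k => [|k IH] kS.
  by exists set0; rewrite ?sub0set ?cards0 // => i j; rewrite inE.
have [T [TS Tk] Tlt] := IH (ltnW kS).
have /card_gt0P[i0 i0S] : (0 < #|S :\: T|)%N.
  by rewrite cardsD (setIidPr TS) Tk subn_gt0.
case: (@arg_minP _ _ _ i0 (mem (S :\: T)) f i0S) => i /= iST imin.
have /setDP[iS iT] := iST.
exists (i |: T).
  by rewrite subUset sub1set iS TS cardsU1 iT Tk.
move=> j l /setU1P[->|jT] /setDP[lS]; rewrite in_setU1 negb_or => /andP[li lT].
  have fil : f i <= f l by apply: imin; apply/setDP.
  by rewrite lt_neqAle fil andbT; apply: contra_neq li => /(f_inj _ _ iS lS).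
by apply: Tlt; rewrite // inE lT.
Qed.

(* A composition of two unimodular shears: it preserves orientations. The slope e
   makes the ordinates distinct, then s chooses the abscissas. *)
Definition shear (R : pzRingType) (e s : R) (z : R * R) : R * R :=
  (z.1 - s * (z.2 + e * z.1), z.2 + e * z.1).

Lemma orient_shear (R : realFieldType) (e s : R) a b c :
  orient (shear e s a) (shear e s b) (shear e s c) = orient a b c.
Proof. by rewrite /orient /shear /=; ring. Qed.

Section Coordinates.
Variables (R : realFieldType) (n : nat) (p : 'I_n -> R * R).
Hypothesis p_inj : injective p.
Hypothesis o_neq0 : forall i j k : 'I_n,
  i != j -> j != k -> i != k -> orient (p i) (p j) (p k) != 0.

(** With [b] lowest, a point [m] gets an abscissa left of that of [b] exactly when its inverse slope
    [f m] seen from [b] is below [s]. These values are distinct as no three points are collinear, so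
    [s] can be put just after the [x] smallest; at least [x] others remain. *)
Lemma exists_shear_lowest_median x : (0 < x)%N -> (2 * x < n)%N ->
  exists e s (b : 'I_n), let q i := shear e s (p i) in
    [/\ injective (fun i => (q i).1),
        forall m, m != b -> (q b).2 < (q m).2,
        (x <= #|[set m | ((q m).1 < (q b).1)%R]|)%N &
        (x <= #|[set m | ((q b).1 < (q m).1)%R]|)%N].
Proof.
move=> x0 xn.
(* The finitely many [e] that could give two points the same ordinate; [bad_s] does the same for
   abscissas. *)
pose bad_e := [seq - ((p ij.1).2 - (p ij.2).2) / ((p ij.1).1 - (p ij.2).1)
               | ij : 'I_n * 'I_n].
have [e _ e_good] := exists_between_notin bad_e (@ltr01 R).
pose X i := (p i).1; pose Y i := (p i).2 + e * X i.
have Y_inj : injective Y.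
  move=> i j Yij; have [Xij|Xij] := eqVneq (X i) (X j).
    apply: p_inj; rewrite [LHS]surjective_pairing [RHS]surjective_pairing.
    by congr (_, _) => //; move: Yij; rewrite /Y Xij => /addIr.
  case/negP: e_good; apply/mapP; exists (i, j); first by rewrite mem_enum.
  rewrite /=; apply: canRL (mulfK _) _; first by rewrite subr_eq0.
  by move: Yij; rewrite /Y /X; lra.
have i0 : 'I_n by apply: (@Ordinal n 0); lia.
case: (@arg_minP _ _ _ i0 predT Y isT) => b _ bmin.
have Yb m : m != b -> Y b < Y m.
  by move=> mb; rewrite lt_neqAle bmin // andbT eq_sym (inj_eq Y_inj).
pose f m := (X m - X b) / (Y m - Y b).
pose S := [set~ b].
have f_inj : {in S &, injective f}.
  move=> i j; rewrite !inE => ib jb.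
  have := Yb i ib; have := Yb j jb => Yj Yi.
  move/eqP; rewrite eqr_div ?subr_eq0 ?(gt_eqF Yi) ?(gt_eqF Yj) // => /eqP fij.
  apply/eqP/negPn/negP => ij.
  have /negP[] : orient (p b) (p i) (p j) != 0.
    by apply: o_neq0; rewrite // eq_sym.
  by apply/eqP; move: fij; rewrite /orient /Y /X; lra.
have S_card : #|S| = n.-1 by rewrite cardsC1 card_ord.
have [|T [TS Tx] Tlt] := exists_initial_subset (k := x) f_inj; first by lia.
have STx : (x <= #|S :\: T|)%N.
  by rewrite cardsD (setIidPr TS) S_card Tx; lia.
have /card_gt0P[t0 t0T] : (0 < #|T|)%N by rewrite Tx.
have /card_gt0P[u0 u0T] : (0 < #|S :\: T|)%N by apply: leq_trans STx.
case: (@arg_maxP _ _ _ t0 (mem T) f t0T) => t /= tT tmax.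
case: (@arg_minP _ _ _ u0 (mem (S :\: T)) f u0T) => u /= uT umin.
pose bad_s := [seq (X ij.1 - X ij.2) / (Y ij.1 - Y ij.2) | ij : 'I_n * 'I_n].
have [s /andP[ts su] s_good] := exists_between_notin bad_s (Tlt _ _ tT uT).
exists e, s, b; rewrite /shear; split => /=.
- move=> i j /= qij; apply/eqP/negPn/negP => ij.
  case/negP: s_good; apply/mapP; exists (i, j); first by rewrite mem_enum.
  rewrite /=; apply: canRL (mulfK _) _.
    by rewrite subr_eq0 (inj_eq Y_inj).
  by move: qij; rewrite /Y /X; lra.
- exact: Yb.
- rewrite -Tx; apply/subset_leq_card/subsetP => m mT; rewrite inE.
  have mb : m != b by have := subsetP TS m mT; rewrite !inE.
  have Ym := Yb m mb.
  have : f m < s by apply: le_lt_trans ts; apply: tmax.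
  rewrite /f ltr_pdivrMr ?subr_gt0 //.
  by rewrite /Y /X; lra.
- apply: leq_trans STx _; apply/subset_leq_card/subsetP => m mT; rewrite inE.
  have mb : m != b by move: mT => /setDP[]; rewrite !inE.
  have Ym := Yb m mb.
  have : s < f m by apply: lt_le_trans su _; apply: umin.
  rewrite /f ltr_pdivlMr ?subr_gt0 //.
  by rewrite /Y /X; lra.
Qed.

End Coordinates.

(** The rank of a point is the number of points with a smaller value; [g] lists the points by
    rank. *)
Lemma exists_sorting (R : realFieldType) n (f : 'I_n -> R) : injective f ->
  exists rk g : 'I_n -> 'I_n, [/\ cancel rk g, cancel g rk,
    forall i j : 'I_n, (i < j)%N -> f (g i) < f (g j) &
    forall i, val (rk i) = #|[set m | f m < f i]|].
Proof.
move=> f_inj.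
pose below i := [set m | f m < f i].
have below_lt i : (#|below i| < n)%N.
  rewrite -[X in (_ < X)%N]card_ord -cardsT; apply: proper_card.
  by rewrite properT; apply/negP => /eqP/setP/(_ i); rewrite !inE ltxx.
have below_mono i j : f i <= f j -> (#|below i| <= #|below j|)%N.
  move=> ij; apply/subset_leq_card/subsetP => m; rewrite !inE => /lt_le_trans.
  exact.
have below_smono i j : f i < f j -> (#|below i| < #|below j|)%N.
  move=> ij; apply: proper_card; apply/properP; split.
    by apply/subsetP => m; rewrite !inE => /lt_trans; apply.
  by exists i; rewrite !inE ?ltxx.
pose rk i := Ordinal (below_lt i).
have rk_inj : injective rk.
  move=> i j /(congr1 val)/= rij; apply: f_inj; apply/eqP/negPn.
  by rewrite neq_lt; apply/negP => /orP[] /below_smono; rewrite rij ltnn.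
have [g rkK gK] := injF_bij rk_inj.
exists rk, g; split=> // i j ij; rewrite ltNge; apply/negP => /below_mono.
by have := congr1 val (gK i); have := congr1 val (gK j) => /= -> ->; lia.
Qed.

(** * From a drawing of the complete graph to the integer bound *)

Section Drawings.
Variable R : realType.

(** Of three collinear points one lies on the segment between the others, and that segment is an
    edge. *)
Lemma drawing_orient n (p : 'I_n -> R * R) : injective p ->
  (forall i j v : 'I_n, (i < j)%N -> v != i -> v != j ->
     ~ on_seg R (p v) (p i) (p j)) ->
  forall i j k : 'I_n, i != j -> j != k -> i != k ->
    orient (p i) (p j) (p k) != 0.
Proof.
move=> p_inj p_seg.
have noseg i j v : i != j -> v != i -> v != j -> ~ on_seg R (p v) (p i) (p j).
  rewrite neq_ltn => /orP[ij vi vj|ji vi vj /on_segC]; exact: p_seg.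
move=> i j k ij jk ik; apply/eqP => /collinear_on_seg[].
- by move/p_inj/eqP; apply/negP.
- by apply: noseg; rewrite // eq_sym.
- exact: noseg.
- by apply: noseg; rewrite // eq_sym.
Qed.

Lemma crossing_swap (a b c d : R * R) : crossing b a c d = crossing a b c d.
Proof.
rewrite /crossing (orient_swapl b a c) (orient_swapl b a d) mulrNN.
by rewrite [X in _ && (X < 0)]mulrC.
Qed.

Lemma crossing_sym (a b c d : R * R) : crossing c d a b = crossing a b c d.
Proof. by rewrite /crossing andbC. Qed.

Theorem drawable_bound n k x : Kn_geom_drawable R n k ->
  (0 < x)%N -> (2 * x < n)%N ->
  ('C(n, 2) <= 2 * 'C(x, 2) + 3 + k * (3 * n - (2 * x + 7)))%N.
Proof.
move=> [p [c [p_inj [p_seg p_nocross]]]] x0 xn.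
have o_neq0 := drawing_orient p_inj p_seg.
(* Layers are prescribed on increasing pairs only, and sorting permutes the indices, so the
   colouring is made symmetric. *)
pose col (i j : 'I_n) := if (i < j)%N then c i j else c j i.
have col_nocross i j i' j' : i != j -> i' != j' -> col i j = col i' j' ->
    ~~ crossing (p i) (p j) (p i') (p j').
  have aux (a b a' b' : 'I_n) : (a < b)%N -> (a' < b')%N -> c a b = c a' b' ->
      ~~ crossing (p a) (p b) (p a') (p b').
    move=> ab ab' cc; have [[<- <-]|ne] := eqVneq (a, b) (a', b').
      by rewrite /crossing orientx mul0r ltxx.
    apply/negP => /crossing_meet[z [z1 z2 za zb]].
    by have [[]] := p_nocross _ _ _ _ ab ab' ne cc z z1 z2.
  rewrite /col; case: ltngtP => // [ij|ji|/val_inj->]; last by rewrite eqxx.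
    case: ltngtP => // [ij'|ji'|/val_inj->]; last by rewrite eqxx.
      by move=> _ _; apply: aux.
    by move=> _ _ ?; rewrite crossing_sym crossing_swap crossing_sym aux.
  rewrite crossing_swap; case: ltngtP => // [ij'|ji'|/val_inj->].
  - by move=> _ _; apply: aux.
  - by move=> _ _ ?; rewrite crossing_sym crossing_swap crossing_sym aux.
  - by rewrite eqxx.
have [e [s [b]]] := exists_shear_lowest_median p_inj o_neq0 x0 xn.
set q := fun i => shear e s (p i) => -[q_inj b_low b_left b_right].
have [rk [g [rkK gK g_incr rkE]]] := exists_sorting q_inj.
have g_inj := can_inj gK.
have xb : (x <= rk b)%N by rewrite rkE.
(* The points left of [b], those right of [b] and [b] itself are disjoint. *)
have bx : (rk b < n - x)%N.
  rewrite rkE; move: b_right.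
  set L := [set m | _ < _ b]; set U := [set m | _ < _].
  have LU0 : L :&: U = set0.
    by apply/setP => m; rewrite !inE; case: ltgtP.
  have : (#|L :|: U| <= #|[set~ b]|)%N.
    apply/subset_leq_card/subsetP => m; rewrite !inE => LUm.
    by apply: contraL LUm => /eqP->; rewrite ltxx.
  have := cardsUI L U; rewrite LU0 cards0 cardsC1 card_ord addn0; lia.
have := @sorted_bound R n k (q \o g) (fun i j => col (g i) (g j)) g_incr _ _
  (rk b) _ x x0 xb bx.
apply.
- move=> i j l ij jl il; rewrite /= orient_shear.
  by apply: o_neq0; rewrite (inj_eq g_inj).
- move=> i j i' j' ij ij' cc; rewrite /crossing /= !orient_shear.
  by apply: col_nocross cc; rewrite (inj_eq g_inj) -val_eqE ltn_eqF.
- move=> m mb; rewrite /= rkK; apply: b_low.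
  by apply: contra_neq mb => <-; rewrite gK.
Qed.

End Drawings.

(** * The ratio bound and the linear bound over the reals *)

Section Ratio.
Variable R : realType.

Lemma natr_bin2 m : 2 * 'C(m, 2)%:R = m%:R * (m%:R - 1) :> R.
Proof.
elim: m => [|m IH]; first by rewrite bin0n mulr0 mul0r.
by rewrite binS bin1 natrD mulrDr IH -natr1; ring.
Qed.

Lemma drawable_boundr n k x : Kn_geom_drawable R n k ->
  (4 <= n)%N -> (0 < x)%N -> (2 * x < n)%N ->
  'C(n, 2)%:R - 2 * 'C(x, 2)%:R - 3 <= k%:R * (3 * n%:R - 2 * x%:R - 7) :> R.
Proof.
move=> draw n4 x0 xn; have := drawable_bound draw x0 xn.
rewrite -(ler_nat R) !natrD !natrM natrB; last by lia.
by rewrite natrD !natrM; lra.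
Qed.

Lemma drawable_ratio n k x : Kn_geom_drawable R n k ->
  (4 <= n)%N -> (0 < x)%N -> (2 * x <= n)%N ->
  ('C(n, 2)%:R - 2 * 'C(x, 2)%:R - 3) / (3 * n%:R - 2 * x%:R - 7) <= k%:R :> R.
Proof.
move=> draw n4 x0 xn.
have n4R : 4 <= n%:R :> R by rewrite (ler_nat R 4).
have xnR : 2 * x%:R <= n%:R :> R by rewrite -natrM ler_nat.
rewrite ler_pdivrMr; last by lra.
(* When [2 * x = n], no point has [x] others on each side; the bound at [x - 1] is then the stronger
   one. *)
move: xn; rewrite leq_eqVlt => /orP[/eqP xn|]; last exact: drawable_boundr.
have x1 : (0 < x.-1)%N by lia.
have xn1 : (2 * x.-1 < n)%N by lia.
have := drawable_boundr draw n4 x1 xn1.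
have := natr_bin2 n; have := natr_bin2 x; have := natr_bin2 x.-1.
rewrite -subn1 natrB // -xn natrM.
have : 2 <= x%:R :> R by rewrite (ler_nat R 2); lia.
move: x%:R k%:R ('C(x - 1, 2)%:R) ('C(x, 2)%:R) ('C(2 * x, 2)%:R).
move=> m K A B C m2 A2 B2 C2 K_ge.
have {}K_ge : m ^+ 2 + 2 * m - 5 <= K * (4 * m - 5) by nra.
suff : m ^+ 2 - 3 <= K * (4 * m - 7) by nra.
have m5 : 0 < 4 * m - 5 by lra.
rewrite -(ler_pM2r m5).
have : (m ^+ 2 + 2 * m - 5) * (4 * m - 7) <= K * (4 * m - 5) * (4 * m - 7).
  by rewrite ler_pM2r //; lra.
(* This product is [(m ^+ 2 + 2 * m - 5) * (4 * m - 7) - (m ^+ 2 - 3) * (4 * m - 5)]. *)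
have : 0 <= 2 * (3 * m - 5) * (m - 2) by rewrite !mulr_ge0 //; lra.
by lra.
Qed.

(** Two convergents of the continued fraction of the root. The upper one gives (3 - sqrt 7) / 2 > 48
    / 271 > 1 / 5.646. *)
Lemma sqrt7_bounds : 82 / 31 < Num.sqrt (7 : R) < 717 / 271.
Proof.
have s0 := sqrtr_ge0 (7 : R).
have s2 : Num.sqrt 7 ^+ 2 = 7 :> R by rewrite sqr_sqrtr.
by apply/andP; split; nra.
Qed.

Lemma drawable_linear n k : Kn_geom_drawable R n k -> (12 <= n)%N ->
  (3 - Num.sqrt 7) / 2 * n%:R + 342 / 1000 <= k%:R :> R.
Proof.
move=> draw n12.
have n12R : 12 <= n%:R :> R by rewrite (ler_nat R 12).
have /andP[s_gt s_lt] := sqrt7_bounds.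
have s2 : Num.sqrt 7 ^+ 2 = 7 :> R by rewrite sqr_sqrtr.
move: s_gt s_lt s2; set s : R := Num.sqrt 7 => s_gt s_lt s2.
(* At [n = 12] the remainder [rem] below is slightly negative; there [x = 3] gives 57 / 23
   directly. *)
have [n13|] := ltnP 12 n; last first.
  move=> n12'; have {n12 n12' n12R} n12 : n = 12 by lia.
  subst n; have := drawable_boundr (x := 3) draw isT isT isT.
  by rewrite (_ : 'C(12, 2) = 66)%N // (_ : 'C(3, 2) = 3)%N //; lra.
have n13R : 13 <= n%:R :> R by rewrite (ler_nat R 13).
set c := (X in X <= _).
have sn_gt : 82 / 31 * n%:R <= s * n%:R by rewrite ler_wpM2r // ltW.
have sn_lt : s * n%:R <= 717 / 271 * n%:R by rewrite ler_wpM2r // ltW.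
have c0 : 0 < c by rewrite /c; lra.
have c1 : 0 <= c + 1 by lra.
have /andP[xc cx] := truncn_itv c1.
move: (Num.truncn (c + 1)) xc cx => x xc; rewrite -natr1 => cx.
have x0 : (0 < x)%N by rewrite -(ltr_nat R); lra.
have xn : (2 * x < n)%N.
  by rewrite -(ltr_nat R) natrM; move: xc; rewrite /c; lra.
have n4 : (4 <= n)%N by lia.
have := drawable_boundr draw n4 x0 xn.
have := natr_bin2 n; have := natr_bin2 x.
have xnR : 2 * x%:R < n%:R :> R by rewrite -natrM ltr_nat.
have D0 : 0 < 3 * n%:R - 2 * x%:R - 7 :> R by lra.
move=> Cx Cn bound; rewrite -(ler_pM2r D0).
apply: le_trans _ bound.
(* Here [c < x <= c + 1]. The desired inequality is the sum of [pos], which absorbs [x], and [rem0],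
   which is free of [x]. *)
have pos : 0 <= (x%:R - c) * (c + 1 - x%:R) by apply: mulr_ge0; lra.
(* The quadratic term vanishes since (3 - sqrt 7) / 2 is a root of y^2 - 3y + 1/2; the linear
   coefficient that remains is about 0.012. *)
have rem : c ^+ 2 + 8 * c - 3 * c * n%:R + n%:R * (n%:R - 1) / 2 - 3
    = (s ^+ 2 - 7) / 4 * n%:R ^+ 2
      + (23 / 2 * n%:R - (4 + 342 / 1000) * (s * n%:R))
      + (342 / 1000) ^+ 2 + 8 * (342 / 1000) - 3.
  by rewrite /c; field.
rewrite s2 subrr !mul0r add0r in rem.
have rem0 : 0 <= c ^+ 2 + 8 * c - 3 * c * n%:R + n%:R * (n%:R - 1) / 2 - 3.
  by rewrite rem; lra.
by clearbody c; move: pos rem0 Cx Cn; clear; lra.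
Qed.

End Ratio.

Theorem theorem3p1 (R : realType) :
  (forall n : nat, (4 <= n)%N ->
     forall x : nat, (1 <= x)%N -> (2 * x <= n)%N ->
       geom_thickness_Kn_ge R n
         (('C(n, 2)%:R - 2 * 'C(x, 2)%:R - 3) /
          (3 * n%:R - 2 * x%:R - 7))) /\
  (forall n : nat, (12 <= n)%N ->
     geom_thickness_Kn_ge R n
       (Num.ceil ((3 - Num.sqrt 7) / 2 * n%:R + 342 / 1000 : R))%:~R /\
     Num.ceil (n%:R / (5646 / 1000) + 342 / 1000 : R)
       <= Num.ceil ((3 - Num.sqrt 7) / 2 * n%:R + 342 / 1000 : R)).
Proof.
split=> [n n4 x x0 xn k draw | n n12]; first exact: drawable_ratio.
split=> [k draw|].
  rewrite -[leRHS]/(k%:Z%:~R) ler_int ceil_le_int.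
  exact: drawable_linear.
apply: le_ceil; rewrite lerD2r mulrC ler_wpM2r //.
by have /andP[_ s_lt] := sqrt7_bounds R; lra.
Qed.
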